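(* Let $\mathbb K$ be an algebraically closed field of characteristic $0$ and let $$\mathcal B=\mathrm{diag}(\underbrace{b_1,\ldots,b_1}_{\alpha_1},\ldots,\underbrace{b_m,\ldots,b_m}_{\alpha_m},a_1,\ldots,a_k)\in M_n(\mathbb K),$$ where $k,m\ge 0$ are integers, $a_1,\ldots,a_k,b_1,\ldots,b_m\in\mathbb K$ are pairwise distinct and $\alpha_1,\ldots,\alpha_m\ge 2$ are integers. Then $\mathcal B$ is integrable if and only if its characteristic polynomial $p_{\mathcal B}(x)$ has a full integral.
   Context: For a square matrix $M$, $p_M(x)=\det(xI-M)$. For $B\in M_n(\mathbb K)$ put $\tau(B)=\frac{1}{n}\mathrm{tr}(B)$. A matrix $A\in M_{n+1}(\mathbb K)$ is an integral of $B\in M_n(\mathbb K)$ if $A=\begin{pmatrix} B & u^{\top}\\ v & \tau(B)\end{pmatrix}$ for some row vectors $u,v\in\mathbb K^n$ and $p_B(x)=\frac{1}{n+1}p_A'(x)$. The matrix $B$ is integrable if it has an integral. A polynomial $P\in\mathbb K[x]$ is a full integral of $p\in\mathbb K[x]$ if $P'=p$ and for every $\lambda\in\mathbb K$ with $(x-\lambda)^2\mid p$ one has $(x-\lambda)\mid P$. *)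

(* Defs.v *)
From HB Require Import structures.
From mathcomp Require Import all_boot all_order all_algebra.

Set Implicit Arguments.
Unset Strict Implicit.
Unset Printing Implicit Defensive.

Import GRing.Theory.
Local Open Scope ring_scope.

(* For n = 0 the convention 0^-1 = 0 gives tau B = 0. *)
Definition tau (K : fieldType) (n : nat) (B : 'M[K]_n) : K :=
  n%:R^-1 * \tr B.

Definition is_integral (K : fieldType) (n : nat)
    (A : 'M[K]_(n + 1)) (B : 'M[K]_n) : Prop :=
  (exists u v : 'rV[K]_n, A = block_mx B u^T v (tau B)%:M) /\
  char_poly B = (n + 1)%:R^-1 *: (char_poly A)^`().

Definition integrable (K : fieldType) (n : nat) (B : 'M[K]_n) : Prop :=
  exists A : 'M[K]_(n + 1), is_integral A B.

Definition full_integral (K : fieldType) (p P : {poly K}) : Prop :=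
  P^`() = p /\
  forall lambda : K,
    ('X - lambda%:P) ^+ 2 %| p -> ('X - lambda%:P) %| P.

(* The diagonal lists alpha i copies of b i, for i = 0, ..., m - 1, and then
   the entries of a. *)
Definition calB (K : fieldType) (m k : nat) (alpha : 'I_m -> nat)
    (b : 'I_m -> K) (a : 'I_k -> K) : 'M[K]_(\sum_(i < m) alpha i + k) :=
  diag_mx (row_mx (\mxrow_(i < m) (const_mx (b i) : 'rV[K]_(alpha i)))
                  (\row_(j < k) a j)).

(* Main.v *)
(* Expanding the bordered determinant,
     p_A = (x - t) p - \sum_i u_i v_i \prod_(j != i) (x - d_j),
   where p = \prod_i (x - d_i).  Each term is divisible by x - l when (x - l)^2
   divides p, so p_A / (n + 1) is a full integral of p.  Conversely, if P is a
   full integral of p, then R = (x - tau) p - (n + 1) P has degree < n, and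
   every root l of p of multiplicity e is a root of R of multiplicity at least
   e - 1.  Hence R / p has simple poles and its partial fraction expansion
   provides the products u_i v_i.  The multiplicities of the d_i never have to
   be made explicit, so the argument is carried out for an arbitrary diagonal
   matrix. *)
Require Import Defs.
From HB Require Import structures.
From mathcomp Require Import all_boot all_order all_algebra.
From mathcomp Require Import ring.

Set Implicit Arguments.
Unset Strict Implicit.
Unset Printing Implicit Defensive.

Import GRing.Theory.
Local Open Scope ring_scope.

Lemma char_poly_diag_mx (R : comNzRingType) (n : nat) (d : 'rV[R]_n) :
  char_poly (diag_mx d) = \prod_i ('X - (d 0 i)%:P).
Proof.
rewrite char_poly_trig ?diag_mx_is_trig //.
by apply: eq_bigr => i _; rewrite mxE eqxx mulr1n.
Qed.

Lemma char_poly_bordered_diag (K : fieldType) (n : nat) (d : 'rV[K]_n)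
    (u v : 'rV[K]_n) (t : K) :
  char_poly (block_mx (diag_mx d) u^T v t%:M) =
  ('X - t%:P) * \prod_i ('X - (d 0 i)%:P)
  - \sum_i (u 0 i * v 0 i) *: \prod_(j | j != i) ('X - (d 0 j)%:P).
Proof.
set p := \prod_i _; set s := \sum_i _.
have p_neq0 : p != 0 by rewrite monic_neq0 // monic_prod_XsubC.
pose e : 'rV[{poly K}]_n := \row_i ('X - (d 0 i)%:P).
(* [N] is the adjugate of [diag_mx e], so their product is the scalar matrix [p] and no inverse is
   taken. *)
pose N : 'M[{poly K}]_n :=
  diag_mx (\row_i \prod_(j | j != i) ('X - (d 0 j)%:P)).
have eN : diag_mx e *m N = p%:M.
  rewrite mulmx_diag; apply/matrixP => i j; rewrite !mxE.
  by congr (_ *+ _); rewrite [RHS](bigD1 i).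
have -> : char_poly (block_mx (diag_mx d) u^T v t%:M) =
    \det (block_mx (diag_mx e) (- map_mx polyC u^T) (- map_mx polyC v)
            ('X - t%:P)%:M).
  rewrite /char_poly /char_poly_mx (map_block_mx (polyC : K -> {poly K})).
  rewrite opp_block_mx (scalar_mx_block n 1) add_block_mx .
  rewrite !sub0r; apply: congr1.
  congr (block_mx _ _ _ _).
    apply/matrixP=> i j; rewrite !mxE; case: eqVneq => [->|] /=.
      by rewrite !mulr1n.
    by rewrite !mulr0n polyC0 subr0.
  by apply/matrixP=> i j; rewrite !mxE !ord1 /= !mulr1n.
set M := block_mx _ _ _ _.
(* This clears the upper right corner of M without dividing, at the cost of a
   factor p cancelled at the end. *)
have : M *m block_mx 1%:M (N *m map_mx polyC u^T) 0 p%:M =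
    block_mx (diag_mx e) 0 (- map_mx polyC v) (('X - t%:P) * p - s)%:M.
  rewrite mulmx_block !mulmx1 !mulmx0 !addr0; congr (block_mx _ _ _ _).
    by rewrite mulmxA eN mul_mx_scalar mul_scalar_mx scalerN subrr.
  apply/matrixP => i j; rewrite !ord1 -scalar_mxM addrC.
  rewrite mxE [X in X + _]mxE [RHS]mxE eqxx !mulr1n; congr (_ + _).
  rewrite mulNmx mxE mxE; congr (- _); apply: eq_bigr => k _.
  by rewrite mul_diag_mx !mxE -mul_polyC polyCM; ring.
move/(congr1 determinant); rewrite det_mulmx det_ublock det_lblock.
rewrite det1 mul1r !det_scalar1 det_diag.
under eq_bigr do rewrite mxE.
by rewrite -/p [RHS]mulrC => /(mulIf p_neq0).
Qed.

(** A double root [l] is the value of at least two of the [d i], so it remains a root of the product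
    after one factor is omitted. *)
Lemma dvdp_bordered_diag (K : fieldType) (n : nat) (d c : 'I_n -> K)
    (t l : K) :
  ('X - l%:P) ^+ 2 %| \prod_i ('X - (d i)%:P) ->
  'X - l%:P %| ('X - t%:P) * \prod_i ('X - (d i)%:P)
    - \sum_i c i *: \prod_(j | j != i) ('X - (d j)%:P).
Proof.
move=> l2p; apply: dvdp_sub.
  by apply/dvdp_mull/(dvdp_trans _ l2p); rewrite expr2 dvdp_mulIl.
rewrite dvdp_XsubCl rootE horner_sum big1 // => i _.
rewrite hornerZ; apply/eqP; rewrite mulf_eq0; apply/orP; right.
rewrite -rootE; apply: contraLR l2p => nroot.
rewrite (bigD1 i) //= Gauss_dvdpl; last first.
  by rewrite coprimep_sym coprimep_expr // coprimep_XsubC.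
apply/negP => /dvdp_leq; rewrite polyXsubC_eq0 => /(_ isT).
by rewrite size_exp_XsubC size_XsubC.
Qed.

(* The divisibility condition says that R / p has only simple poles. *)
Lemma simple_partial_fractions (K : fieldType) (n : nat) (d : 'I_n -> K)
    (R : {poly K}) :
  (size R <= n)%N ->
  (forall (l : K) (e : nat), ('X - l%:P) ^+ e.+1 %| \prod_i ('X - (d i)%:P) ->
     ('X - l%:P) ^+ e %| R) ->
  exists c : 'I_n -> K,
    R = \sum_i c i *: \prod_(j | j != i) ('X - (d j)%:P).
Proof.
elim: n d R => [|n IHn] d R szR mulR.
  exists (fun=> 0); rewrite big_ord0.
  by apply/eqP; rewrite -size_poly_leq0.
set l0 := d ord0; set q := \prod_(i < n) ('X - (d (lift ord0 i))%:P).
move: mulR; rewrite big_ord_recl -/q -/l0 => mulR.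
have szq : size q = n.+1 by rewrite size_prod_XsubC /index_enum -enumT size_enum_ord.
(* The value at [l0] forces this coefficient when [l0] is a simple root. Otherwise [q.[l0] = 0], the
   division returns 0, and [R] itself vanishes at [l0]. *)
pose c0 := R.[l0] / q.[l0].
have Rl0 : root q l0 -> R.[l0] = 0.
  move=> ql0; apply/eqP; rewrite -rootE -dvdp_XsubCl -['X - _]expr1 mulR //.
  by rewrite expr2 dvdp_mul2l ?polyXsubC_eq0 // dvdp_XsubCl.
have /factor_theorem[S defS] : root (R - c0 *: q) l0.
  rewrite rootE !hornerE /c0; have [q0|q0] := eqVneq q.[l0] 0.
    by rewrite q0 Rl0 ?rootE ?q0 // mulr0 subr0.
  by rewrite divfK // subrr.
have szS : (size S <= n)%N.
  have [->|S0] := eqVneq S 0; first by rewrite size_poly0.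
  rewrite -ltnS.
  have <- : size (S * ('X - l0%:P)) = (size S).+1.
    by rewrite size_Mmonic ?monicXsubC // size_XsubC addn2.
  rewrite -defS (leq_trans (size_polyD _ _)) // geq_max szR size_polyN.
  by rewrite (leq_trans (size_scale_leq _ _)) ?szq.
(* If [l = l0], then [c0 = 0], and the extra factor of the full product gives [R] one more power,
   which pays for the division by ['X - l0%:P]. If not, that division is coprime to the power of
   ['X - l%:P]. *)
have mulS l e : ('X - l%:P) ^+ e.+1 %| q -> ('X - l%:P) ^+ e %| S.
  move=> lq; have [El|l_neq] := eqVneq l l0.
    have ql0 : root q l0.
      by rewrite -dvdp_XsubCl -El (dvdp_trans _ lq) // exprS dvdp_mulIl.
    have : ('X - l%:P) ^+ e.+1 %| R.
      by apply: mulR; rewrite exprS El dvdp_mul2l ?polyXsubC_eq0 // -El.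
    have -> : R = S * ('X - l0%:P).
      by rewrite -defS /c0 Rl0 // mul0r scale0r subr0.
    by rewrite exprSr El dvdp_mul2r ?polyXsubC_eq0.
  have cop : coprimep (('X - l%:P) ^+ e) ('X - l0%:P).
    by apply/coprimep_expl/coprimep_XsubC2; rewrite subr_eq0 eq_sym.
  rewrite -(Gauss_dvdpl _ cop) -defS dvdp_sub ?mulR ?dvdp_mull //.
  by rewrite -mul_polyC dvdp_mull // (dvdp_trans _ lq) // dvdp_exp2l.
have [c defS'] := IHn _ _ szS mulS.
exists (fun i => if unlift ord0 i is Some j then c j else c0).
rewrite big_ord_recl unlift_none -[LHS](subrK (c0 *: q)) addrC; congr (_ + _).
  by rewrite big_mkcond big_ord_recl /= mul1r.
rewrite defS {1}defS' mulr_suml; apply: eq_bigr => i _.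
rewrite liftK -scalerAl; congr (_ *: _).
rewrite [in RHS]big_mkcond big_ord_recl /= mulrC -big_mkcond /=; congr (_ * _).
Qed.

(** Fullness supplies a first factor of [P] at a multiple root of [p]. In characteristic 0 each
    further factor comes from differentiating [Q * ('X - l%:P) ^+ e.+1]: the term with the nonzero
    coefficient [e.+1] forces ['X - l%:P] to divide [Q]. *)
Lemma full_integral_dvdp (K : fieldType) (p P : {poly K}) (l : K) (e : nat) :
  [pchar K] =i pred0 -> full_integral p P ->
  ('X - l%:P) ^+ e.+1 %| p -> ('X - l%:P) ^+ e %| P.
Proof.
move=> /pcharf0P char0 [<- fullP]; case: e => [|e] ldP; first by rewrite dvd1p.
have lP : 'X - l%:P %| P by apply/fullP/(dvdp_trans _ ldP)/dvdp_exp2l.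
elim: e ldP => [//|e IHe] ldP.
have /dvdpP[Q defP] : ('X - l%:P) ^+ e.+1 %| P.
  by apply/IHe/(dvdp_trans _ ldP)/dvdp_exp2l.
have: ('X - l%:P) ^+ e.+1 %| P^`() by apply: dvdp_trans ldP; apply: dvdp_exp2l; rewrite ltnS leqW.
rewrite defP; set x := 'X - l%:P.
have x0 : x != 0 by rewrite polyXsubC_eq0.
rewrite derivM deriv_exp derivXsubC mul1r /= dvdp_addr; last first.
  exact: dvdp_mull.
rewrite mulrnAr -scaler_nat dvdpZr ?char0 // exprS dvdp_mul2r ?expf_neq0 //.
by rewrite -exprS [x ^+ e.+2]exprS => xQ; rewrite dvdp_mul.
Qed.

(** Degree n + 1 cancels because p is monic. Degree n cancels because the next coefficient of p is
    [- \tr B], which is -n times the corner entry [tau B]. For n = 0 the constant term of [P] would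
    be arbitrary. *)
Lemma size_integral_remainder (K : fieldType) (n : nat) (B : 'M[K]_n)
    (P : {poly K}) :
  [pchar K] =i pred0 -> (0 < n)%N -> P^`() = char_poly B ->
  (size (('X - (tau B)%:P) * char_poly B - (n + 1)%:R *: P)%R <= n)%N.
Proof.
move=> /pcharf0P char0 n_gt0 dP; apply/leq_sizeP => -[|i] le_ni.
  by move: n_gt0; rewrite ltnNge le_ni.
set p := char_poly B in dP *.
have szp : size p = n.+1 by rewrite size_char_poly.
have p0 j : (n < j)%N -> p`_j = 0 by move=> ?; rewrite nth_default ?szp.
have pn : p`_n = 1.
  by have /monicP := char_poly_monic B; rewrite lead_coefE -/p szp.
have PE : i.+1%:R * P`_i.+1 = p`_i by rewrite mulr_natl -coef_deriv dP.
have i1_neq0 : i.+1%:R != 0 :> K by rewrite char0.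
apply: (mulfI i1_neq0); rewrite mulr0 coefB coefZ mulrBr mulrCA PE.
rewrite mulrBl coefB coefXM coefCM /=.
move: le_ni; rewrite leq_eqVlt => /orP[/eqP Eni|]; last first.
  rewrite ltnS leq_eqVlt => /orP[/eqP <-|lt_ni].
    by rewrite pn (p0 n.+1) // mulr0 subr0 !mulr1 addn1 subrr.
  by rewrite !p0 ?leqW // !(mulr0, subr0).
have -> : p`_i = - \tr B.
  by rewrite -[i]/(i.+1.-1) -Eni char_poly_trace.
rewrite -Eni pn mulr1 mulrBr /tau mulrA divff ?char0 -?lt0n // natrD.
ring.
Qed.

Theorem integrable_diag_mx (K : fieldType) (n : nat) (d : 'rV[K]_n) :
  [pchar K] =i pred0 ->
  integrable (diag_mx d) <->
  exists P : {poly K}, full_integral (char_poly (diag_mx d)) P.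
Proof.
move=> charK0; have /pcharf0P char0 := charK0.
have n1_neq0 : (n + 1)%:R != 0 :> K by rewrite char0 addn1.
split=> [[_ [[u [v ->]] intA]]|[P fullP]].
  exists ((n + 1)%:R^-1 *:
    char_poly (block_mx (diag_mx d) u^T v (tau (diag_mx d))%:M)).
  split=> [|l]; first by rewrite derivZ -intA.
  rewrite dvdpZr ?invr_eq0 // char_poly_diag_mx char_poly_bordered_diag.
  exact: dvdp_bordered_diag.
set t := tau (diag_mx d); set p := char_poly _ in fullP *.
(* [Q] is [P] except for n = 0, where the sum is empty and the constant of integration has to be
   0. *)
have [Q [c dQ defQ]] : exists Q : {poly K}, exists2 c : 'I_n -> K, Q^`() = p &
    ('X - t%:P) * p - (n + 1)%:R *: Q =
    \sum_i c i *: \prod_(j | j != i) ('X - (d 0 j)%:P).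
  have [n0|n_gt0] := posnP n.
    subst n; exists 'X, (fun=> 0).
      by rewrite derivX /p char_poly_diag_mx big_ord0.
    rewrite /p char_poly_diag_mx /t /tau /mxtrace !big_ord0 mulr0 polyC0 subr0.
    by rewrite mulr1 scale1r subrr.
  exists P; have szR := size_integral_remainder charK0 n_gt0 fullP.1.
  have [l e lp|c defR] := simple_partial_fractions (d := d 0) szR.
    rewrite -char_poly_diag_mx -/p in lp.
    rewrite dvdp_sub //.
      by rewrite dvdp_mull // (dvdp_trans _ lp) // dvdp_exp2l.
    by rewrite dvdpZr // (full_integral_dvdp charK0 fullP).
  by exists c; first exact: fullP.1.
(* Only the products of the entries of [u] and [v] enter the determinant, so [v] can be all ones. *)
exists (block_mx (diag_mx d) (\row_i c i)^T (const_mx 1) t%:M).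
split; first by do 2!eexists.
rewrite char_poly_bordered_diag -char_poly_diag_mx -/p.
under eq_bigr do rewrite !mxE mulr1.
by rewrite -defQ subKr derivZ scalerA mulVf // scale1r dQ.
Qed.

Theorem theorem3p8 (K : closedFieldType) (charK0 : [pchar K] =i pred0)
    (k m : nat) (alpha : 'I_m -> nat) (b : 'I_m -> K) (a : 'I_k -> K)
    (a_inj : injective a) (b_inj : injective b)
    (ab_neq : forall (i : 'I_k) (j : 'I_m), a i <> b j)
    (alpha_ge2 : forall i : 'I_m, (2 <= alpha i)%N) :
  integrable (calB alpha b a) <->
  exists P : {poly K}, full_integral (char_poly (calB alpha b a)) P.
Proof. exact: integrable_diag_mx. Qed.
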